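(* Let $q\in\mathbb{C}$ be such that $[n]_q\neq 0$ for all $n\geq 1$, let $u,\alpha\in\mathbb{C}$, and let $(a_n^{(\alpha)})_{n\ge0}$ be complex numbers with $a_0^{(\alpha)}\neq0$, $(\mathcal{A}_q(t))^{\alpha}=\sum_{n\ge0}a_n^{(\alpha)}\frac{t^n}{[n]_q!}$. Let $\mathrm{P}_{n,q}^{(\alpha)}(x)$ be defined by $(\mathcal{A}_q(t))^{\alpha}\mathrm{e}_q(tx)=\sum_{n\ge0}\mathrm{P}_{n,q}^{(\alpha)}(x)\frac{t^n}{[n]_q!}$ and $\mathrm{P}_{n,q}^{(\alpha)}(x,y;u)$ by $(\mathcal{A}_q(t))^{\alpha}\mathrm{e}_q(tx)\mathrm{e}_q(ty,u)=\sum_{n\ge0}\mathrm{P}_{n,q}^{(\alpha)}(x,y;u)\frac{t^n}{[n]_q!}$. Let $\mathrm{T}(yD_q|u)$ be the linear operator on polynomials in $x$ (with coefficients depending on $y$) determined by $\mathrm{T}(yD_q|u)\{x^n\}=\mathrm{R}_n(x,y;u|q)$ for all $n\ge0$. Then for all $n\ge0$, $$\mathrm{P}_{n,q}^{(\alpha)}(x,y;u)=\mathrm{T}(yD_q|u)\{\mathrm{P}_{n,q}^{(\alpha)}(x)\}.$$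
   Context: $[n]_q=\frac{1-q^n}{1-q}$, $[n]_q!=[1]_q\cdots[n]_q$ ($[0]_q!=1$). $\mathrm{e}_q(z,u)=\sum_{n\ge0}u^{\binom{n}{2}}\frac{z^n}{[n]_q!}$ (convention $0^0=1$), $\mathrm{e}_q(z)=\mathrm{e}_q(z,1)$. The deformed homogeneous polynomials $\mathrm{R}_n(x,y;u|q)$ are defined by $\mathrm{e}_q(tx)\mathrm{e}_q(ty,u)=\sum_{n\ge0}\mathrm{R}_n(x,y;u|q)\frac{t^n}{[n]_q!}$, i.e. $\mathrm{R}_n(x,y;u|q)=\sum_{k=0}^n\frac{[n]_q!}{[k]_q![n-k]_q!}u^{\binom{k}{2}}y^kx^{n-k}$. Identities are of formal power series in $t$. *)

(* Defs.v *)
From HB Require Import structures.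
From mathcomp Require Import all_boot all_order all_algebra.
From mathcomp Require Import reals complex.
Set Implicit Arguments.
Unset Strict Implicit.
Unset Printing Implicit Defensive.
Import Order.TTheory GRing.Theory Num.Theory.
Local Open Scope ring_scope.
Local Open Scope complex_scope.

(* The quotient (1 - q^n) / (1 - q) is read as its limit n at q = 1, so that
   q = 1 is covered. *)
Definition qint (K : fieldType) (q : K) (n : nat) : K :=
  if q == 1 then n%:R else (1 - q ^+ n) / (1 - q).

Definition qfact (K : fieldType) (q : K) (n : nat) : K :=
  \prod_(1 <= i < n.+1) qint q i.

(* A formal power series in t over B is its sequence of coefficients; equality
   of series is pointwise equality =1. *)
Definition fps (B : nzRingType) : Type := nat -> B.

Definition fps_mul (B : nzRingType) (f g : fps B) : fps B :=
  fun n => \sum_(k < n.+1) f k * g (n - k)%N.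

(* The complex numbers will be K = R[i] for a realType R. Below,
   iota embeds the scalars K in the coefficient ring B (B is a ring of
   polynomials in x, or in x and y). *)

(* The series sum_n c_n t^n / [n]_q! in t. *)
Definition qegf (K : fieldType) (B : nzRingType) (iota : {rmorphism K -> B})
    (q : K) (c : nat -> B) : fps B :=
  fun n => iota ((qfact q n)^-1) * c n.

(* e_q(tz, u), as a series in t, for z in B. *)
Definition qexp2 (K : fieldType) (B : nzRingType) (iota : {rmorphism K -> B})
    (q u : K) (z : B) : fps B :=
  qegf iota q (fun n => iota (u ^+ 'C(n, 2)) * z ^+ n).

(* e_q(tz), as a series in t. *)
Definition qexp (K : fieldType) (B : nzRingType) (iota : {rmorphism K -> B})
    (q : K) (z : B) : fps B :=
  qexp2 iota q 1 z.

(* K[x, y] is {poly {poly K}}: the outer variable is x and the inner one is y,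
   so that its scalars {poly K} are the coefficients depending on y. *)
Definition polyCC (K : fieldType) : {rmorphism K -> {poly {poly K}}} :=
  polyC \o polyC.

Definition varx (K : fieldType) : {poly {poly K}} := 'X.
Definition vary (K : fieldType) : {poly {poly K}} := 'X%:P.
Arguments polyCC {K}.
Arguments varx {K}.
Arguments vary {K}.

Definition Rpoly (K : fieldType) (q u : K) (n : nat) : {poly {poly K}} :=
  \sum_(k < n.+1)
     polyCC (qfact q n / (qfact q k * qfact q (n - k)) * u ^+ 'C(k, 2))
       * vary ^+ k * varx ^+ (n - k).

(* A linear operator on K[y][x] is determined by its values on the powers of x,
   which can be prescribed arbitrarily. *)
Lemma linear_op_exists (B : comNzRingType) (r : nat -> {poly B}) :
  exists T : {linear {poly B} -> {poly B}}, forall n, T 'X^n = r n.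
Proof.
pose f (p : {poly B}) : {poly B} := \sum_(i < size p) p`_i *: r i.
have fE m (p : {poly B}) : (size p <= m)%N -> f p = \sum_(i < m) p`_i *: r i.
  move=> pm; rewrite /f (big_ord_widen m (fun i => p`_i *: r i)) //.
  rewrite [LHS]big_mkcond; apply: eq_bigr => i _.
  by case: ltnP => // /leq_sizeP ->; rewrite // scale0r.
have flin : linear f.
  move=> a p s; pose m := maxn (size p) (size s).
  have pm : (size p <= m)%N by exact: leq_maxl.
  have sm : (size s <= m)%N by exact: leq_maxr.
  rewrite (fE m p) // (fE m s) // (fE m) //.
    rewrite scaler_sumr -big_split /=; apply: eq_bigr => i _.
    by rewrite coefD coefZ scalerDl scalerA.
  rewrite (leq_trans (size_polyD _ _)) // geq_max sm andbT.
  exact: leq_trans (size_scale_leq _ _) pm.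
pose H := GRing.isLinear.Build B {poly B} {poly B} _ f flin.
pose T : {linear {poly B} -> {poly B}} := HB.pack f H.
exists T => n; rewrite /= (fE n.+1) ?size_polyXn // big_ord_recr /=.
rewrite coefXn eqxx scale1r big1 ?add0r // => i _.
by rewrite coefXn ltn_eqF // scale0r.
Qed.

Lemma linear_op_unique (B : comNzRingType) (T T' : {linear {poly B} -> {poly B}}) :
  (forall n, T 'X^n = T' 'X^n) -> T =1 T'.
Proof.
move=> TT' p; rewrite -[p]coefK poly_def !linear_sum /=.
by apply: eq_bigr => i _; rewrite !linearZ /= TT'.
Qed.

(* Main.v *)
(** The operator T sends the coefficient x^n / [n]_q! of e_q(tx) to
R_n / [n]_q!, the coefficient of e_q(tx) e_q(ty,u); it therefore maps the
series A e_q(tx) to A e_q(tx) e_q(ty,u), the coefficients of A being scalars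
for T. *)

Require Import Defs.
From HB Require Import structures.
From mathcomp Require Import all_boot all_order all_algebra.
From mathcomp Require Import reals complex ring.
Set Implicit Arguments.
Unset Strict Implicit.
Unset Printing Implicit Defensive.
Import Order.TTheory GRing.Theory Num.Theory.
Local Open Scope ring_scope.
Local Open Scope complex_scope.

Section FormalPowerSeries.
Variable B : nzRingType.
Implicit Types f g h : fps B.

(** A coefficient of index at most [n] in a product involves only coefficients of index at most [n]
    of the factors. Truncation thus reduces laws of series to laws of [{poly B}]. *)
Lemma coef_truncM f g (n k : nat) : (k <= n)%N ->
  (\poly_(i < n.+1) f i * \poly_(i < n.+1) g i)`_k = fps_mul f g k.
Proof.
move=> kn; rewrite coefM; apply: eq_bigr => i _.
have ik : (i <= k)%N by rewrite -ltnS.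
by rewrite !coef_poly !ltnS (leq_trans ik kn) (leq_trans (leq_subr i k) kn).
Qed.

Lemma eq_fps_mul f f' g g' :
  f =1 f' -> g =1 g' -> fps_mul f g =1 fps_mul f' g'.
Proof. by move=> ff' gg' n; apply: eq_bigr => k _; rewrite ff' gg'. Qed.

Lemma fps_mulA f g h :
  fps_mul (fps_mul f g) h =1 fps_mul f (fps_mul g h).
Proof.
move=> n; pose t (e : fps B) := \poly_(i < n.+1) e i.
have tE e k : (k <= n)%N -> (t e)`_k = e k by rewrite coef_poly ltnS => ->.
(* Both sides are the coefficient of index [n] of a triple product of truncations, where
   associativity of polynomials applies. *)
transitivity ((t f * t g * t h)`_n).
  rewrite coefM; apply: eq_bigr => k _.
  by rewrite coef_truncM ?tE ?leq_subr // -ltnS.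
rewrite -mulrA coefM; apply: eq_bigr => k _.
by rewrite coef_truncM ?tE ?leq_subr // -ltnS.
Qed.

End FormalPowerSeries.

Section QExponentials.
Variables (K : fieldType) (q : K).
Hypothesis qint_neq0 : forall n : nat, (1 <= n)%N -> qint q n != 0.

Lemma qfact_neq0 n : qfact q n != 0.
Proof.
rewrite /qfact big_nat; elim/big_rec: _ => [|i x /andP[i_gt0 _] x_neq0].
  exact: oner_neq0.
by rewrite mulf_neq0 ?qint_neq0.
Qed.

Lemma qexpE (B : nzRingType) (iota : {rmorphism K -> B}) (z : B) n :
  qexp iota q z n = iota (qfact q n)^-1 * z ^+ n.
Proof. by rewrite /qexp /qexp2 /qegf expr1n rmorph1 mul1r. Qed.

Lemma polyCC_scale (c : K) (p : {poly {poly K}}) : polyCC c * p = c%:P *: p.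
Proof. exact: mul_polyC. Qed.

(** Dividing the q-binomial coefficient by [qfact q n] leaves the product of the inverses of
    [qfact q (n - k)] and [qfact q k], one from each exponential. *)
Lemma qexp_mul_qexp2 (u : K) :
  fps_mul (qexp polyCC q varx) (qexp2 polyCC q u vary)
  =1 qegf polyCC q (Rpoly q u).
Proof.
move=> n; rewrite /qegf /Rpoly mulr_sumr /fps_mul.
(* The convolution is indexed by the power of x, [Rpoly] by the power of y. *)
rewrite (reindex_inj rev_ord_inj) /=; apply: eq_bigr => k _.
have kn : (k <= n)%N by rewrite -ltnS.
rewrite subSS subKn // qexpE /qexp2 /qegf.
rewrite !mulrA -[polyCC (qfact q n)^-1 * _]rmorphM.
have -> : (qfact q n)^-1
    * (qfact q n / (qfact q k * qfact q (n - k)) * u ^+ 'C(k, 2))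
  = (qfact q (n - k))^-1 * (qfact q k)^-1 * u ^+ 'C(k, 2).
  by field; rewrite !qfact_neq0.
by rewrite !(rmorphM polyCC); ring.
Qed.

Lemma T_qAppell (u : K) (c : nat -> K) (P : nat -> {poly K})
    (Pxy : nat -> {poly {poly K}})
    (T : {linear {poly {poly K}} -> {poly {poly K}}}) :
    fps_mul (qegf polyC q (fun n => (c n)%:P)) (qexp polyC q 'X)
      =1 qegf polyC q P ->
    fps_mul (fps_mul (qegf polyCC q (fun n => polyCC (c n)))
                     (qexp polyCC q varx))
            (qexp2 polyCC q u vary)
      =1 qegf polyCC q Pxy ->
    (forall n, T 'X^n = Rpoly q u n) ->
  forall n, Pxy n = T ((P n)^:P).
Proof.
move=> hP hPxy hT n.
have qV_neq0 : polyCC (qfact q n)^-1 != 0.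
  by rewrite !polyC_eq0 invr_eq0 qfact_neq0.
(* With the factor 1/[n]_q! restored, both sides become series coefficients; on the right it passes
   inside [T] by linearity. *)
apply: (mulfI qV_neq0); rewrite [RHS]polyCC_scale -linearZ /=.
rewrite -[LHS]/(qegf polyCC q Pxy n) -hPxy fps_mulA.
rewrite (eq_fps_mul (frefl _) (qexp_mul_qexp2 u)).
(* The factor moves on inside the embedding of K[x] in K[y][x], so that [hP] expands the argument of
   [T] as a convolution. *)
rewrite -mul_polyC -map_polyC -rmorphM /= -[X in X^:P]/(qegf polyC q P n) -hP.
rewrite rmorph_sum linear_sum; apply: eq_bigr => k _.
rewrite qexpE !rmorphM /= !map_polyC map_polyXn /=.
(* On the right, [T] now acts on a scalar multiple of ['X^(n - k)]. *)
by rewrite /qegf -!mulrA !polyCC_scale !(linearZ_LR T) hT.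
Qed.

End QExponentials.

Theorem theorem4 (R : realType) (q u alpha : R[i])
    (hq : forall n : nat, (1 <= n)%N -> qint q n != 0)
    (a : R[i] -> nat -> R[i]) (ha : a alpha 0%N != 0)
    (P : nat -> {poly R[i]})
    (hP : fps_mul (qegf polyC q (fun n => (a alpha n)%:P))
                  (qexp polyC q 'X)
          =1 qegf polyC q P)
    (Pxy : nat -> {poly {poly R[i]}})
    (hPxy : fps_mul (fps_mul (qegf polyCC q (fun n => polyCC (a alpha n)))
                             (qexp polyCC q varx))
                    (qexp2 polyCC q u vary)
            =1 qegf polyCC q Pxy)
    (T : {linear {poly {poly R[i]}} -> {poly {poly R[i]}}})
    (hT : forall n : nat, T 'X^n = Rpoly q u n) :
  forall n : nat, Pxy n = T ((P n)^:P).
Proof. exact: (T_qAppell hq hP hPxy hT). Qed.
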